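(* Let $L_1,L_2,T,K_1,K_2>0$, $\beta,\gamma\in(1,2]$, let $M_1,M_2\ge2$, $N\ge1$, $J\ge1$ be integers, and let $h_1=L_1/M_1$, $h_2=L_2/M_2$, $\tau=T/N$, $x_i=ih_1$, $y_j=jh_2$, $t_n=n\tau$, $t_{n-1+\sigma}=(n-1+\sigma)\tau$, where $\sigma\in[\frac12,1]$ and the coefficients $\hat c_k^{(n)}$, $g_k^{(\beta)}$, $g_k^{(\gamma)}$ are as defined in the context. Given functions $f$ and $\phi$, put $f_{ij}^{n-1+\sigma}=f(x_i,y_j,t_{n-1+\sigma})$. Then the difference scheme $$\sum_{k=0}^{n-1}\hat c_k^{(n)}\left(u_{ij}^{n-k}-u_{ij}^{n-k-1}\right)=-K_1h_1^{-\beta}\sum_{k=i-M_1}^{i}g_k^{(\beta)}\left[\sigma u_{i-k,j}^n+(1-\sigma)u_{i-k,j}^{n-1}\right]-K_2h_2^{-\gamma}\sum_{k=j-M_2}^{j}g_k^{(\gamma)}\left[\sigma u_{i,j-k}^n+(1-\sigma)u_{i,j-k}^{n-1}\right]+f_{ij}^{n-1+\sigma}$$ for $1\le i\le M_1-1$, $1\le j\le M_2-1$, $1\le n\le N$, with $$u_{ij}^n=0\ \text{ for boundary indices } (i\in\{0,M_1\}\text{ or }j\in\{0,M_2\}),\ 0\le n\le N,\qquad u_{ij}^0=\phi(x_i,y_j),\ 1\le i\le M_1-1,\ 1\le j\le M_2-1,$$ is uniquely solvable, i.e. there is exactly one family $\{u_{ij}^n: 0\le i\le M_1,\ 0\le j\le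 M_2,\ 0\le n\le N\}$ of real numbers satisfying it.
   Context: Weight function: $\omega:[0,1]\to\mathbb{R}$ satisfies $\omega(\alpha)\ge 0$ and $\omega(\alpha)\ne0$ for $\alpha\in[0,1]$, and $0<\int_0^1\omega(\alpha)\,d\alpha<\infty$. Set $m=2J$, $\Delta\alpha=\frac1{2J}$, $\alpha_r=r\Delta\alpha$ for $0\le r\le m$, $d_0=d_m=\frac12$, $d_r=1$ for $1\le r\le m-1$, and $\lambda_r=d_r\omega(\alpha_r)\Delta\alpha>0$. $\sigma$ is the unique positive root (it lies in $[\frac12,1]$) of $$F(\sigma)=\sum_{r=0}^{m}\frac{\lambda_r}{\Gamma(3-\alpha_r)}\sigma^{1-\alpha_r}\left[\sigma-\left(1-\frac{\alpha_r}{2}\right)\right]\tau^{2-\alpha_r}=0 .$$ For $\alpha\in[0,1]$ let $a_0^{(\alpha)}=\sigma^{1-\alpha}$ and, for $l\ge1$, $a_l^{(\alpha)}=(l+\sigma)^{1-\alpha}-(l-1+\sigma)^{1-\alpha}$ and $$b_l^{(\alpha)}=\frac{1}{2-\alpha}\left[(l+\sigma)^{2-\alpha}-(l-1+\sigma)^{2-\alpha}\right]-\frac12\left[(l+\sigma)^{1-\alpha}+(l-1+\sigma)^{1-\alpha}\right].$$ Let $c_0^{(1,\alpha)}=a_0^{(\alpha)}$, and for $n\ge2$: $c_0^{(n,\alpha)}=a_0^{(\alpha)}+b_1^{(\alpha)}$; $c_k^{(n,\alpha)}=a_k^{(\alpha)}+b_{k+1}^{(\alpha)}-b_k^{(\alpha)}$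 for $1\le k\le n-2$; $c_{n-1}^{(n,\alpha)}=a_{n-1}^{(\alpha)}-b_{n-1}^{(\alpha)}$. Define $$\hat c_k^{(n)}=\sum_{r=0}^{m}\lambda_r\frac{\tau^{-\alpha_r}}{\Gamma(2-\alpha_r)}c_k^{(n,\alpha_r)},\quad 0\le k\le n-1 .$$ For $k\in\mathbb{Z}$ and $s\in(1,2]$, $g_k^{(s)}=\dfrac{(-1)^k\Gamma(s+1)}{\Gamma(s/2-k+1)\Gamma(s/2+k+1)}$, with the convention $1/\Gamma(z)=0$ at the poles of $\Gamma$. The function $\phi$ is assumed to vanish on the boundary of $(0,L_1)\times(0,L_2)$. *)

(* Defs.v *)
From HB Require Import structures.
From mathcomp Require Import all_boot all_order all_algebra.
From mathcomp Require Import all_classical all_reals all_analysis.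

Set Implicit Arguments.
Unset Strict Implicit.
Unset Printing Implicit Defensive.

Import Order.TTheory GRing.Theory Num.Theory.
Local Open Scope classical_set_scope.
Local Open Scope ring_scope.

Section gamma.
Context {R : realType}.
Implicit Type x : R.

Definition Euler_integral x : R :=
  \int[lebesgue_measure]_(t in `]0, +oo[) (t `^ (x - 1) * expR (- t)).

(* Gamma(x) = Gamma(x + n) / (x (x + 1) ... (x + n - 1)), where n is the least
   natural number with x + n > 0 (so n = 0 when x > 0). At the poles
   x = 0, -1, -2, ... the denominator vanishes, so Gamma x = 0 and
   (Gamma x)^-1 = 0, which is the convention 1/Gamma(x) = 0. *)
Definition Gamma x : R :=
  let n := Num.truncn (1 - x) in
  Euler_integral (x + n%:R) / \prod_(i < n) (x + i%:R).

End gamma.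

Section coefficients.
Context {R : realType}.
Implicit Types (omega : R -> R) (J n k l r : nat) (sigma tau alpha s : R).

Definition dalpha J : R := (2 * J)%:R^-1.

Definition alpha_ J r : R := r%:R * dalpha J.

Definition d_ J r : R := if (r == 0%N) || (r == 2 * J)%N then 2^-1 else 1.

Definition lambda_ omega J r : R := d_ J r * omega (alpha_ J r) * dalpha J.

Definition sigma_eq_fun omega J tau sigma : R :=
  \sum_(0 <= r < (2 * J).+1)
    lambda_ omega J r / Gamma (3 - alpha_ J r) * sigma `^ (1 - alpha_ J r)
    * (sigma - (1 - alpha_ J r / 2)) * tau `^ (2 - alpha_ J r).

Definition a_ sigma alpha l : R :=
  if l is l'.+1 then
    (l%:R + sigma) `^ (1 - alpha) - (l'%:R + sigma) `^ (1 - alpha)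
  else sigma `^ (1 - alpha).

(* Only used for 1 <= l. *)
Definition b_ sigma alpha l : R :=
  (2 - alpha)^-1 * ((l%:R + sigma) `^ (2 - alpha)
                    - (l%:R - 1 + sigma) `^ (2 - alpha))
  - 2^-1 * ((l%:R + sigma) `^ (1 - alpha) + (l%:R - 1 + sigma) `^ (1 - alpha)).

(* c_k^(n, alpha); only used for 0 <= k <= n - 1. *)
Definition c_ sigma alpha n k : R :=
  if (n <= 1)%N then a_ sigma alpha 0
  else if k == 0%N then a_ sigma alpha 0 + b_ sigma alpha 1
  else if (k <= n - 2)%N then
    a_ sigma alpha k + b_ sigma alpha k.+1 - b_ sigma alpha k
  else a_ sigma alpha k - b_ sigma alpha k.

Definition chat omega J tau sigma n k : R :=
  \sum_(0 <= r < (2 * J).+1)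
    lambda_ omega J r * (tau `^ (- alpha_ J r) / Gamma (2 - alpha_ J r))
    * c_ sigma (alpha_ J r) n k.

Definition g_ s (k : int) : R :=
  (-1) ^ k * Gamma (s + 1)
  / (Gamma (s / 2 - k%:~R + 1) * Gamma (s / 2 + k%:~R + 1)).

End coefficients.

Section scheme.
Context {R : realType}.

Definition grid_fun (M1 M2 N : nat) : Type :=
  {ffun 'I_M1.+1 * 'I_M2.+1 * 'I_N.+1 -> R}.

(* u_{ij}^n; only used for i <= M1, j <= M2 and n <= N. *)
Definition at_ M1 M2 N (u : grid_fun M1 M2 N) (i j n : nat) : R :=
  u (inord i, inord j, inord n).

(* The value sigma u_{ij}^n + (1 - sigma) u_{ij}^{n-1}, for 1 <= n. *)
Definition at_sigma M1 M2 N (sigma : R) (u : grid_fun M1 M2 N)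
    (i j n : nat) : R :=
  sigma * at_ u i j n + (1 - sigma) * at_ u i j n.-1.

(* The two spatial sums are indexed by p = i - k and q = j - k, which range
   over 0..M1 and 0..M2 when k ranges over i - M1..i and j - M2..j. *)
Definition is_scheme_solution (L1 L2 T K1 K2 beta gamma : R)
    (M1 M2 N J : nat) (omega : R -> R) (sigma : R)
    (f : R -> R -> R -> R) (phi : R -> R -> R) (u : grid_fun M1 M2 N) : Prop :=
  let h1 := L1 / M1%:R in
  let h2 := L2 / M2%:R in
  let tau := T / N%:R in
  [/\ forall i j n : nat, (1 <= i <= M1 - 1)%N -> (1 <= j <= M2 - 1)%N ->
        (1 <= n <= N)%N ->
        \sum_(0 <= k < n) chat omega J tau sigma n k
                          * (at_ u i j (n - k) - at_ u i j (n - k - 1))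
        = - K1 * h1 `^ (- beta)
            * (\sum_(0 <= p < M1.+1)
                 g_ beta (i%:Z - p%:Z) * at_sigma sigma u p j n)
          - K2 * h2 `^ (- gamma)
            * (\sum_(0 <= q < M2.+1)
                 g_ gamma (j%:Z - q%:Z) * at_sigma sigma u i q n)
          + f (i%:R * h1) (j%:R * h2) ((n%:R - 1 + sigma) * tau),
      forall i j n : nat, (i <= M1)%N -> (j <= M2)%N -> (n <= N)%N ->
        [|| i == 0%N, i == M1, j == 0%N | j == M2] -> at_ u i j n = 0
    & forall i j : nat, (1 <= i <= M1 - 1)%N -> (1 <= j <= M2 - 1)%N ->
        at_ u i j 0 = phi (i%:R * h1) (j%:R * h2)].

End scheme.
Arguments grid_fun : clear implicits.

(* Main.v *)
Require Import Defs.
From HB Require Import structures.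
From mathcomp Require Import all_boot all_order all_algebra.
From mathcomp Require Import all_classical all_reals all_analysis.
From mathcomp Require Import measurable_realfun ring lra zify.

Import Order.TTheory GRing.Theory Num.Theory.
Import numFieldNormedType.Exports.
Local Open Scope classical_set_scope.
Local Open Scope ring_scope.

(** The unknowns at level [n] are determined by those at the earlier levels
through a linear system with as many equations as unknowns, so it is enough
that the homogeneous problem has only the zero solution. Levels are treated in
order. When all the levels before [n] vanish, only the term [k = 0] of the
time sum survives, and the equation at an interior node reads
  [chat_0 u_ij = - K1 h1^-beta sigma S1 - K2 h2^-gamma sigma S2],
where [S1] and [S2] are the two spatial sums applied to [u^n]. At a node where
[|u_ij|] is maximal, [u_ij S1 >= 0] and [u_ij S2 >= 0], so that
[chat_0 u_ij^2 <= 0]; as [chat_0 > 0] ([chat_gt0]), the level vanishes.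

The sign of [u_ij S1] is diagonal dominance of the matrix [g_(i-p)]: its
off-diagonal entries are nonpositive and its row sums are nonnegative. Both
come from one two-term recurrence ([g_rec]),
  [(k + 1 + s/2) g_(k+1) = (k - s/2) g_k].
It fixes the signs ([g_le0]), and it telescopes: [(k + s/2) g_k] decreases by
[s g_k] from [k] to [k + 1], whence [g_0 + ... + g_n >= g_0 / 2]
([half_sum_g_ge]). A row sum consists of two such one-sided sums that share
[g_0] ([sum_g_row_ge0]).

The recurrence is the functional equation [Gamma (x + 1) = x Gamma x]
([GammaS]). Away from the positive half-line it is part of the definition of
[Gamma]; on it, it is integration by parts in Euler's integral. The integrand
may be singular at 0 and the domain is unbounded, so the fundamental theorem
of calculus is applied on compact intervals exhausting [(0, +oo)], and
monotone convergence gives the limit. *)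

(** * Euler's integral *)

Section euler_integral.
Context {R : realType}.
Notation mu := (@lebesgue_measure R).
Implicit Types (x t a b : R) (f g G : R -> R) (n : nat).

(** Compact intervals of the open half-line that increase to it. The shift by 2
makes the left end smaller than the right one for every [n]. *)
Definition window n : set R := `[n.+2%:R^-1, n.+2%:R]%classic.

Lemma window_gt0 n t : window n t -> 0 < t.
Proof.
by rewrite /window/= in_itv/= => /andP[+ _]; apply: lt_le_trans; rewrite invr_gt0.
Qed.

Lemma window_lt n : n.+2%:R^-1 < n.+2%:R :> R.
Proof.
by rewrite (@lt_trans _ _ 1)// ?ltr1n// invf_lt1// ltr1n.
Qed.

Lemma bigcup_window : \bigcup_n window n = `]0, +oo[%classic.
Proof.
apply/seteqP; split => t/=.
  by move=> [n _ /window_gt0 t0]; rewrite in_itv/= t0.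
rewrite in_itv/= andbT => t0.
(* The index bounds both [t] and [t^-1]. *)
exists (Num.truncn (t + t^-1)) => //; rewrite /window/= in_itv/=.
have tV0 : 0 < t^-1 by rewrite invr_gt0.
have /andP[_ h] := @truncn_itv _ (t + t^-1) (ltW (addr_gt0 t0 tV0)).
have le2 : (Num.truncn (t + t^-1)).+1%:R <= (Num.truncn (t + t^-1)).+2%:R :> R.
  by rewrite ler_nat.
apply/andP; split; last by lra.
rewrite -[leRHS]invrK lef_pV2 ?posrE//; lra.
Qed.

Lemma measurable_fun_pos f : (forall t, 0 < t -> {for t, continuous f}) ->
  measurable_fun (`]0%R, +oo[ : set R) f.
Proof.
move=> cf; apply: open_continuous_measurable_fun => //.
by move=> t; rewrite inE/= in_itv/= andbT; exact: cf.
Qed.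

Lemma measurable_fun_window f n : (forall t, 0 < t -> {for t, continuous f}) ->
  measurable_fun (window n) (EFin \o f).
Proof.
move=> cf; apply/measurable_EFinP.
apply: measurable_funS (measurable_fun_pos _ cf) => //.
by move=> t /window_gt0 t0; rewrite /= in_itv/= t0.
Qed.

(** Monotone convergence reduces Euler's integral, improper at both ends, to
compact intervals on which the fundamental theorem of calculus applies. *)
Lemma cvg_integral_window f :
  (forall t, 0 < t -> 0 <= f t) -> (forall t, 0 < t -> {for t, continuous f}) ->
  (\int[mu]_(t in window n) (f t)%:E)%E @[n --> \oo] -->
  (\int[mu]_(t in `]0%R, +oo[) (f t)%:E)%E.
Proof.
move=> f0 cf; rewrite -bigcup_window.
apply: ge0_nondecreasing_set_cvg_integral => //.
- apply/nondecreasing_seqP => n; rewrite subsetEset; apply: subset_itv.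
    by rewrite bnd_simp lef_pV2 ?posrE// ler_nat.
  by rewrite bnd_simp ler_nat.
- by move=> n; exact: measurable_itv.
- by move=> n; exact: measurable_fun_window.
- by move=> n t /window_gt0 t0; rewrite lee_fin f0.
Qed.

Lemma integral_derive_pos G g a b : 0 < a -> a < b ->
  (forall t, 0 < t -> is_derive t 1 G (g t)) ->
  (forall t, 0 < t -> {for t, continuous g}) ->
  (\int[mu]_(t in `[a, b]) (g t)%:E = (G b - G a)%:E)%E.
Proof.
move=> a0 ab dG cg.
have cG t : 0 < t -> {for t, continuous G}.
  by move=> t0; apply/differentiable_continuous/derivable1_diffP; have [] := dG _ t0.
have b0 := lt_trans a0 ab.
rewrite (@continuous_FTC2 _ g G a b)//.
- apply: continuous_in_subspaceT => t; rewrite inE/= in_itv/= => /andP[at_ _].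
  by apply: cg; exact: lt_le_trans at_.
- split.
  + move=> t; rewrite in_itv/= => /andP[at_ _].
    by have [] := dG _ (lt_trans a0 at_).
  + by apply: cvg_at_right_filter; exact: cG.
  + by apply: cvg_at_left_filter; exact: cG.
- move=> t; rewrite in_itv/= => /andP[at_ _].
  by rewrite derive1E; have [_ ->] := dG _ (lt_trans a0 at_).
Qed.

Definition euler_integrand x t : R := t `^ (x - 1) * expR (- t).

Lemma euler_integrand_ge0 x t : 0 <= euler_integrand x t.
Proof. by rewrite mulr_ge0 ?powR_ge0 ?expR_ge0. Qed.

Lemma continuous_powR_pos x t : 0 < t -> {for t, continuous (fun t => t `^ x)}.
Proof.
move=> t0; apply/differentiable_continuous/derivable1_diffP.
by have [] := @is_derive1_powR R x t t0.
Qed.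

Lemma continuous_euler_integrand x t : 0 < t ->
  {for t, continuous (euler_integrand x)}.
Proof.
move=> t0; apply: continuousM; first exact: continuous_powR_pos.
apply: (@continuous_comp _ _ _ -%R (@expR R)); first exact: opp_continuous.
exact: continuous_expR.
Qed.

(** Half of the exponential is enough to absorb the power; the other half
remains available for decay at infinity. *)
Lemma powR_le_expR_half x : 0 < x ->
  exists2 K : R, 0 < K & forall t, 0 <= t -> t `^ x <= K * expR (t / 2).
Proof.
move=> x0; set m := Num.truncn x.
have xm : x <= m.+1%:R by have /andP[_ /ltW] := truncn_itv (ltW x0).
(* For [t <= 1] the power is at most 1; for [t >= 1] it is at most [t^(m+1)],
   which the term of degree [m+1] of the exponential series at [t/2] bounds. *)
pose B : R := 2 ^+ m.+1 * m.+1`!%:R.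
have B0 : 0 < B by rewrite mulr_gt0 ?exprn_gt0// ltr0n fact_gt0.
exists (1 + B) => [|t t0]; first by rewrite addr_gt0.
have e1 : 1 <= expR (t / 2) by rewrite -[leLHS]expR0 ler_expR divr_ge0.
have [t1|/ltW t1] := leP t 1.
  have : t `^ x <= 1.
    have := @ge0_ler_powR R x (ltW x0) t 1.
    by rewrite !nnegrE powR1; apply.
  move=> /le_trans; apply; rewrite (le_trans e1)// ler_peMl ?expR_ge0//.
  by rewrite lerDl ltW.
apply: (le_trans (ler_powR t1 xm)); rewrite powR_mulrn//.
have /= h : 1 + (t / 2) ^+ m.+1 / m.+1`!%:R <= expR (t / 2).
  by apply: expR_ge1Dxn; rewrite divr_ge0.
have -> : t ^+ m.+1 = B * ((t / 2) ^+ m.+1 / m.+1`!%:R).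
  rewrite /B expr_div_n; field.
  by rewrite pnatr_eq0 -lt0n fact_gt0 expf_neq0// pnatr_eq0.
apply: (@le_trans _ _ (B * expR (t / 2))).
  by rewrite ler_pM2l//; lra.
by rewrite ler_wpM2r ?expR_ge0// lerDr.
Qed.

(** The boundary term of the integration by parts in [Euler_integralS]. *)
Lemma euler_boundary_cvg x : 0 < x ->
  (fun n => n.+2%:R `^ x * expR (- n.+2%:R)
     - n.+2%:R^-1 `^ x * expR (- n.+2%:R^-1) : R) @ \oo --> (0 : R).
Proof.
move=> x0; rewrite -[X in _ --> X](subr0 0).
have inv0 : (n.+2%:R^-1 : R) @[n --> \oo] --> (0 : R).
  by have := @cvg_harmonic R; rewrite -(cvg_shiftS (@harmonic R)).
apply: cvgB.
- have [K K0 hK] := powR_le_expR_half _ x0.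
  apply: (@squeeze_cvgr _ _ _ _ (fun=> 0) (fun n => K * 2 * n.+2%:R^-1)).
  + apply: nearW => n; rewrite mulr_ge0 ?powR_ge0 ?expR_ge0//=.
    set t : R := n.+2%:R; have t0 : 0 < t by rewrite ltr0n.
    rewrite expRN ler_pdivrMr ?expR_gt0//.
    apply: (le_trans (hK t (ltW t0))).
    have -> : expR t = expR (t / 2) * expR (t / 2).
      by rewrite -expRD -splitr.
    rewrite mulrA ler_wpM2r ?expR_ge0//.
    rewrite -!mulrA ler_peMr ?(ltW K0)// mulrC mulrAC -mulrA ler_pdivlMl//.
    rewrite mulr1; have := expR_ge1Dx (t / 2); lra.
  + exact: cvg_cst.
  + rewrite -[0 : R](mulr0 (K * 2)); apply: cvgM => //; exact: cvg_cst.
- apply: (@squeeze_cvgr _ _ _ _ (fun=> 0) (fun n => n.+2%:R^-1 `^ x)).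
  + apply: nearW => n; rewrite mulr_ge0 ?powR_ge0 ?expR_ge0//=.
    by rewrite ler_piMr ?powR_ge0// expR_le1 oppr_le0 invr_ge0.
  + exact: cvg_cst.
  + by have /cvg_at_rightP := @powR_cvg0 R x x0; apply; split => // n.
Qed.

(** The integrand is compared with the derivative of a bounded function, which
treats the singularity at 0 and the tail at infinity together:
[- (1 + t^x)^-1] takes its values in [(-1, 0)] on the positive half-line and
has derivative [x t^(x-1) / (1 + t^x)^2], while [(1 + t^x)^2] is at most a
constant times [e^t]. *)
Lemma euler_integral_fin x : 0 < x ->
  (\int[mu]_(t in `]0%R, +oo[) (euler_integrand x t)%:E)%E \is a fin_num.
Proof.
move=> x0.
have [K K0 hK] := powR_le_expR_half _ x0.
pose H t : R := - (1 + t `^ x)^-1.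
pose h t : R := x * t `^ (x - 1) / (1 + t `^ x) ^+ 2.
have den0 t : 0 < 1 + t `^ x by rewrite ltr_pwDl// powR_ge0.
have dH t : 0 < t -> is_derive t 1 H (h t).
  move=> t0.
  have dp := @is_derive1_powR R x t t0.
  have dD : is_derive t 1 (fun t => 1 + t `^ x) (x * t `^ (x - 1)).
    by rewrite -[X in is_derive _ _ _ X]add0r; apply: is_deriveD.
  have nz : (fun t => 1 + t `^ x) t != 0 by rewrite gt_eqF.
  have dV := @is_deriveV R (fun t => 1 + t `^ x) t _ _ nz dD.
  have dN : is_derive t 1 H (- (- (1 + t `^ x) ^- 2 *: (x * t `^ (x - 1)))) := is_deriveN dV.
  apply: is_derive_eq dN _.
  by rewrite /h /GRing.scale/=; field; rewrite gt_eqF.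
have ch t : 0 < t -> {for t, continuous h}.
  move=> t0; apply: continuousM.
    apply: continuousM; first exact: cst_continuous.
    exact: continuous_powR_pos.
  apply: continuousV; first by rewrite expf_neq0// gt_eqF.
  apply: (@continuous_comp _ _ _ (fun t => 1 + t `^ x) (fun y : R => y ^+ 2)).
    apply: continuousD; first exact: cst_continuous.
    exact: continuous_powR_pos.
  exact: exprn_continuous.
pose C := (1 + K) ^+ 2 / x.
have C0 : 0 < C by rewrite divr_gt0// exprn_gt0// ltr_pwDl// ltW.
have le_h t : 0 < t -> euler_integrand x t <= C * h t.
  move=> t0; rewrite /euler_integrand /C /h.
  have -> : (1 + K) ^+ 2 / x * (x * t `^ (x - 1) / (1 + t `^ x) ^+ 2) =
    t `^ (x - 1) * ((1 + K) ^+ 2 / (1 + t `^ x) ^+ 2).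
    by field; rewrite !gt_eqF.
  rewrite ler_wpM2l ?powR_ge0// ler_pdivlMr ?exprn_gt0// mulrC expRN.
  rewrite ler_pdivrMr ?expR_gt0//.
  have -> : expR t = expR (t / 2) ^+ 2 by rewrite -expRM_natr divfK// pnatr_eq0.
  rewrite -exprMn ler_pXn2r ?nnegrE//; last 2 first.
  - exact: ltW.
  - by rewrite mulr_ge0 ?expR_ge0// addr_ge0// ltW.
  have := hK t (ltW t0); have : 1 <= expR (t / 2).
    by rewrite -[leLHS]expR0 ler_expR; lra.
  lra.
have dCh t : 0 < t -> is_derive t 1 (fun t => C * H t) (C * h t).
  move=> t0; have dHt := dH t t0.
  exact: (is_deriveZ C dHt).
have cCh t : 0 < t -> {for t, continuous (fun t => C * h t)}.
  by move=> t0; apply: continuousM; [exact: cst_continuous|exact: ch].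
rewrite ge0_fin_numE; last first.
  by apply: integral_ge0 => t _; rewrite lee_fin euler_integrand_ge0.
apply: (@le_lt_trans _ _ C%:E); last exact: ltry.
apply: cvge_to_le (cvg_integral_window _ (fun t _ => euler_integrand_ge0 x t)
  (continuous_euler_integrand x)) _.
apply: nearW => n.
apply: (@le_trans _ _ (\int[mu]_(t in window n) (C * h t)%:E)%E).
  apply: ge0_le_integral => //.
  - exact: measurable_itv.
  - by move=> t _; rewrite lee_fin euler_integrand_ge0.
  - exact: (measurable_fun_window _ _ (continuous_euler_integrand x)).
  - exact: (measurable_fun_window _ _ cCh).
  - by move=> t /window_gt0 t0; rewrite lee_fin le_h.
rewrite /window (integral_derive_pos _ _ _ _ _ _ dCh cCh) ?invr_gt0//; last exact: window_lt.
rewrite lee_fin -mulrBr ler_piMr ?(ltW C0)// /H opprK.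
have den1 t : 1 <= 1 + t `^ x by rewrite lerDl powR_ge0.
have := invf_le1 (den0 n.+2%:R^-1); rewrite den1 => h1.
have : 0 <= (1 + n.+2%:R `^ x)^-1 :> R by rewrite invr_ge0 ltW.
lra.
Qed.

Lemma Euler_integralE x : 0 < x -> (Euler_integral x)%:E =
  (\int[mu]_(t in `]0%R, +oo[) (euler_integrand x t)%:E)%E.
Proof. by move=> x0; rewrite fineK//; exact: euler_integral_fin. Qed.

(** Integration by parts in differentiated form: the derivative of [t^x e^-t]
is [x t^(x-1) e^-t - t^x e^-t], and [t^x e^-t] tends to 0 at both ends of the
half-line. *)
Lemma Euler_integralS x : 0 < x -> Euler_integral (x + 1) = x * Euler_integral x.
Proof.
move=> x0.
pose G t : R := t `^ x * expR (- t).
pose g t : R := x * euler_integrand x t - euler_integrand (x + 1) t.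
have dG t : 0 < t -> is_derive t 1 G (g t).
  move=> t0.
  have dp := @is_derive1_powR R x t t0.
  have dN : is_derive t 1 (fun t : R => - t) (-1).
    exact: (is_deriveN (is_derive_id t 1)).
  have de : is_derive t 1 (fun t => expR (- t)) (expR (- t) * -1).
    exact: (@is_derive1_comp R (@expR R) (fun t : R => - t)).
  have dM : is_derive t 1 G
    (t `^ x *: (expR (- t) * -1) + expR (- t) *: (x * t `^ (x - 1))) :=
    is_deriveM dp de.
  apply: is_derive_eq dM _.
  rewrite /g /euler_integrand /GRing.scale/= addrK; ring.
have x10 : 0 < x + 1 by rewrite addr_gt0.
have cg t : 0 < t -> {for t, continuous g}.
  move=> t0; apply: continuousB; last exact: continuous_euler_integrand.
  by apply: continuousM; [exact: cst_continuous|exact: continuous_euler_integrand].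
have icont f n : (forall t, 0 < t -> {for t, continuous f}) ->
    mu.-integrable (window n) (EFin \o f).
  move=> cf; apply: continuous_compact_integrable; first exact: segment_compact.
  by apply: continuous_in_subspaceT => t /set_mem/window_gt0; exact: cf.
have ieuler y n : mu.-integrable (window n) (EFin \o euler_integrand y).
  exact/icont/continuous_euler_integrand.
have cvgE y : 0 < y ->
    (\int[mu]_(t in window n) euler_integrand y t) @[n --> \oo] --> Euler_integral y.
  move=> y0; apply: fine_cvg; rewrite Euler_integralE//.
  apply: cvg_integral_window => [t _|t]; first exact: euler_integrand_ge0.
  exact: continuous_euler_integrand.
have Dint n : \int[mu]_(t in window n) g t =
   x * \int[mu]_(t in window n) euler_integrand x t
   - \int[mu]_(t in window n) euler_integrand (x + 1) t.
  have mW : measurable (window n) by exact: measurable_itv.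
  rewrite /g RintegralB//; first by rewrite RintegralZl.
  apply: icont => t t0.
  by apply: continuousM; [exact: cst_continuous|exact: continuous_euler_integrand].
have lim1 : (\int[mu]_(t in window n) g t) @[n --> \oo] -->
    x * Euler_integral x - Euler_integral (x + 1).
  under eq_fun do rewrite Dint.
  apply: cvgB; last exact: cvgE.
  by apply: cvgM; [exact: cvg_cst|exact: cvgE].
have lim0 : (\int[mu]_(t in window n) g t) @[n --> \oo] --> (0 : R).
  apply: cvg_trans (euler_boundary_cvg x x0).
  apply: near_eq_cvg; apply: nearW => n.
  rewrite /Rintegral (integral_derive_pos _ _ _ _ _ _ dG cg) ?invr_gt0//.
  exact: window_lt.
have : x * Euler_integral x - Euler_integral (x + 1) = 0.
  exact: (cvg_unique (@Rhausdorff R) lim1 lim0).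
by move/eqP; rewrite subr_eq0 => /eqP.
Qed.

(** Between 1 and 2 the integrand is at least [t^-1 e^-t], hence at least
[e^-2 / 2]. *)
Lemma Euler_integral_gt0 x : 0 < x -> 0 < Euler_integral x.
Proof.
move=> x0; rewrite -lte_fin Euler_integralE//.
pose c : R := 2^-1 * expR (- 2).
have c0 : 0 < c by rewrite mulr_gt0 ?expR_gt0.
apply: (@lt_le_trans _ _ (\int[mu]_(t in `[1%R, 2%R]) c%:E)%E).
  rewrite integral_cst//= lebesgue_measure_itv/= lte_fin ltr1n.
  by rewrite -EFinB -EFinM lte_fin mulr_gt0//; lra.
apply: (@le_trans _ _ (\int[mu]_(t in `[1%R, 2%R]) (euler_integrand x t)%:E)%E).
  apply: ge0_le_integral => //.
  - by move=> t _; rewrite lee_fin ltW.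
  - apply/measurable_EFinP.
    apply: measurable_funS (measurable_fun_pos _ (continuous_euler_integrand x)) => //.
    by move=> t /=; rewrite !in_itv/= => /andP[t1 _]; rewrite (lt_le_trans _ t1).
  - move=> t; rewrite /= in_itv/= => /andP[t1 t2].
    rewrite lee_fin /c /euler_integrand.
    have t0 : 0 < t by exact: lt_le_trans t1.
    rewrite ler_pM ?expR_ge0 ?invr_ge0 ?ler0n//; last by rewrite ler_expR lerN2.
    apply: (@le_trans _ _ t^-1); first by rewrite lef_pV2 ?posrE.
    rewrite -powR_inv1 ?(ltW t0)// ler_powR//; lra.
apply: ge0_subset_integral => //.
- apply/measurable_EFinP; exact: measurable_fun_pos _ (continuous_euler_integrand x).
- by move=> t _; rewrite lee_fin euler_integrand_ge0.
- by move=> t /=; rewrite !in_itv/= => /andP[t1 _]; rewrite (lt_le_trans _ t1).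
Qed.

End euler_integral.

(** * The functional equation of Gamma and the coefficients g *)

Section gamma_function.
Context {R : realType}.
Implicit Types (x s : R) (k n : nat).

Lemma Gamma_pos x : 0 < x -> Gamma x = Euler_integral x.
Proof.
move=> x0; rewrite /Gamma; have -> : Num.truncn (1 - x) = 0%N.
  by apply/truncn0Pn; rewrite -ltNge; lra.
by rewrite addr0 big_ord0 divr1.
Qed.

Lemma Gamma_gt0 x : 0 < x -> 0 < Gamma x.
Proof. by move=> x0; rewrite Gamma_pos// Euler_integral_gt0. Qed.

(** For [x < 0] the two values involve the same Euler integral, and their
denominators differ by the factor [x]. *)
Lemma GammaS x : x != 0 -> Gamma (x + 1) = x * Gamma x.
Proof.
move=> xn0; have [x0|x_le0] := ltP 0 x.
  by rewrite !Gamma_pos ?addr_gt0// Euler_integralS.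
rewrite /Gamma; set n := Num.truncn (1 - (x + 1)).
have Nx : 0 <= - x by rewrite oppr_ge0.
have -> : Num.truncn (1 - x) = n.+1.
  apply: truncn_def; rewrite /n (_ : 1 - (x + 1) = - x); last by ring.
  have := truncn_itv Nx; rewrite -!natr1; lra.
rewrite big_ord_recl addr0 -natr1 addrA addrAC.
have -> : \prod_(i < n) (x + (lift ord0 i)%:R) = \prod_(i < n) (x + 1 + i%:R).
  by apply: eq_bigr => i _; rewrite lift0 -natr1 addrA addrAC.
by rewrite invfM !mulrA [x * _]mulrC mulrK ?unitfE.
Qed.

Lemma Gamma0 : Gamma 0 = 0 :> R.
Proof.
rewrite /Gamma subr0 (_ : Num.truncn 1 = 1%N) ?truncn1//.
by rewrite big_ord_recl addr0 mul0r invr0 mulr0.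
Qed.

(** Passing to the inverse makes the functional equation hold at 0 as well,
where [1/Gamma] vanishes. The recurrence for [g] meets this case: for [s = 2],
[s/2 - k] is 0 at [k = 1]. *)
Lemma invGamma_rec x : (Gamma x)^-1 = x / Gamma (x + 1).
Proof.
have [->|x0] := eqVneq x 0; first by rewrite Gamma0 invr0 mul0r.
by rewrite GammaS//; move: (Gamma x) => y; rewrite invfM mulVKf.
Qed.

Lemma g_sym s (k : int) : g_ s (- k) = g_ s k.
Proof.
rewrite /g_ mulrNz opprK [Gamma (s / 2 + _ + 1) * _]mulrC.
by rewrite -exprz_inv invrN1.
Qed.

(** From [k] to [k + 1] the sign alternates, one Gamma factor of the
denominator moves up by 1 and the other moves down by 1. *)
Lemma g_rec s k : -1 < s -> (k.+1%:R + s / 2) * g_ s k.+1%:Z = (k%:R - s / 2) * g_ s k%:Z.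
Proof.
move=> s1; rewrite /g_ -!exprnP -!pmulrn.
have k0 : 0 <= k%:R :> R by [].
have -> : s / 2 - k.+1%:R + 1 = s / 2 - k%:R by rewrite -natr1; ring.
have -> : s / 2 + k.+1%:R + 1 = s / 2 + k%:R + 1 + 1 by rewrite -natr1; ring.
have z0 : 0 < s / 2 + k%:R + 1 by lra.
have := invGamma_rec (s / 2 - k%:R); have := Gamma_gt0 _ z0.
rewrite (GammaS (s / 2 + k%:R + 1)) ?gt_eqF//; set z := s / 2 + k%:R + 1 in z0 *.
move: (Gamma (s + 1)) (Gamma z) (Gamma (s / 2 - k%:R)) => Gs Gz Gy Gz0.
move: (Gamma (s / 2 - k%:R + 1)) => Gy1 GyE.
rewrite [X in _ * (_ / X)]mulrC !invfM GyE.
rewrite (_ : k.+1%:R + s / 2 = z); last by rewrite /z -natr1; ring.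
move: Gy1^-1 => Gy1V; rewrite exprS; field.
by rewrite (gt_eqF z0) (gt_eqF Gz0).
Qed.

Lemma g0_ge0 s : -1 < s -> 0 <= g_ s 0.
Proof.
move=> s1; rewrite /g_ expr0z mul1r mulr_ge0//; first by rewrite ltW// Gamma_gt0; lra.
by rewrite invr_ge0 mulr_ge0// ltW// Gamma_gt0 ?subr0 ?addr0; lra.
Qed.

Section signs.
Variable s : R.
Hypothesis s_itv : 0 < s <= 2.

(** In [g_rec] the factor [k - s/2] is negative for [k = 0] and nonnegative
for [k >= 1], so the sign of [g_0 >= 0] is reversed at the first step and then
kept. *)
Lemma g_le0 k : g_ s k.+1%:Z <= 0.
Proof.
have /andP[s0 s2] := s_itv; have s1 : -1 < s by lra.
have g0 := g0_ge0 _ s1.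
have pos m : 0 < m.+1%:R + s / 2 by rewrite addr_gt0 ?divr_gt0.
elim: k => [|k IH].
  rewrite -(pmulr_rle0 _ (pos 0%N)) g_rec//.
  by rewrite mulr_le0_ge0//; lra.
rewrite -(pmulr_rle0 _ (pos k.+1)) g_rec// mulr_ge0_le0// -natr1.
have k0 : 0 <= k%:R :> R by [].
lra.
Qed.

(** The recurrence reads [s g_k = (k + s/2) g_k - (k + 1 + s/2) g_(k+1)], so
the sum telescopes to [s/2 g_0 - (n + 1 + s/2) g_(n+1)], whose last term has a
favourable sign. *)
Lemma half_sum_g_ge n : g_ s 0 / 2 <= \sum_(0 <= k < n.+1) g_ s k%:Z.
Proof.
have /andP[s0 s2] := s_itv; have s1 : -1 < s by lra.
have tele : s * \sum_(0 <= k < n.+1) g_ s k%:Z =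
    s / 2 * g_ s 0 - (n.+1%:R + s / 2) * g_ s n.+1%:Z.
  elim: n => [|n IH].
    rewrite big_nat1 (g_rec s 0 s1) -[g_ s 0]/(g_ s 0%:Z) mulr0n sub0r.
    move: (g_ s 0%:Z) => y; lra.
  rewrite big_nat_recr//= mulrDr IH (g_rec s n.+1 s1).
  by move: (g_ s 0) (g_ s n.+1%:Z) => y0 y; field.
rewrite -(ler_pM2l s0) tele.
have := g_le0 n; have n0 : 0 <= n.+1%:R :> R by [].
nra.
Qed.

(** By symmetry the row is made of [g_0, ..., g_i] and [g_1, ..., g_(M-i)]; the
two one-sided bounds add up to [g_0], which is counted twice. *)
Lemma sum_g_row_ge0 M i : (i <= M)%N ->
  0 <= \sum_(0 <= p < M.+1) g_ s (i%:Z - p%:Z).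
Proof.
move=> iM.
rewrite (@big_cat_nat _ _ _ i.+1)//=.
have -> : \sum_(0 <= p < i.+1) g_ s (i%:Z - p%:Z) = \sum_(0 <= p < i.+1) g_ s p%:Z.
  rewrite big_nat_rev/= add0n; apply: eq_big_nat => p /andP[_ pi].
  by rewrite subSS subzn ?leq_subr// subKn.
have h2 := half_sum_g_ge (M - i); rewrite big_nat_recl//= in h2.
have -> : \sum_(i.+1 <= p < M.+1) g_ s (i%:Z - p%:Z) = \sum_(0 <= k < M - i) g_ s k.+1%:Z.
  rewrite -{1}[i.+1]add0n big_addn subSS; apply: eq_bigr => p _.
  by rewrite -g_sym opprB addnS -addSn PoszD addrK.
have := half_sum_g_ge i; lra.
Qed.

End signs.

End gamma_function.

(** * Diagonal dominance *)

Section weighted_row.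
Context {R : realDomainType}.

(** The maximum principle behind diagonal dominance: at an index [i] where
[|w|] is maximal, replacing each [w_p] by [w_i] can only decrease the form,
because [w_i w_p <= w_i^2] and the coefficients off [i] are nonpositive. After
the replacement the form is [w_i^2] times the row sum. *)
Lemma weighted_row_ge0 (G : nat -> R) (w : nat -> R) (M i : nat) : (i <= M)%N ->
  (forall p, (p <= M)%N -> p != i -> G p <= 0) ->
  0 <= \sum_(0 <= p < M.+1) G p ->
  (forall p, (p <= M)%N -> `|w p| <= `|w i|) ->
  0 <= w i * \sum_(0 <= p < M.+1) G p * w p.
Proof.
move=> iM Goff Gsum wmax.
apply: (@le_trans _ _ (\sum_(0 <= p < M.+1) G p * (w i) ^+ 2)).
  by rewrite -mulr_suml mulr_ge0// sqr_ge0.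
rewrite mulr_sumr; apply: ler_sum_nat => p /andP[_ pM].
rewrite [leRHS]mulrCA; have [->|pi] := eqVneq p i; first by rewrite expr2.
apply: ler_wnM2l; first exact: Goff.
rewrite -real_normK ?num_real// expr2 (le_trans (ler_norm _))// normrM.
by rewrite ler_wpM2l// wmax.
Qed.

End weighted_row.

Lemma g_offdiag_le0 {R : realType} (s : R) (k : int) : 0 < s <= 2 -> k != 0 -> g_ s k <= 0.
Proof.
move=> s02; case: k => [[|k]|k] // _; first exact: g_le0.
by rewrite NegzE g_sym; exact: g_le0.
Qed.

Lemma g_row_form_ge0 {R : realType} (s : R) (w : nat -> R) (M i : nat) :
  0 < s <= 2 -> (i <= M)%N ->
  (forall p, (p <= M)%N -> `|w p| <= `|w i|) ->
  0 <= w i * \sum_(0 <= p < M.+1) g_ s (i%:Z - p%:Z) * w p.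
Proof.
move=> s02 iM; apply: weighted_row_ge0 => //; last exact: sum_g_row_ge0.
move=> p _ pi; apply: g_offdiag_le0 => //.
by rewrite subr_eq0 eqz_nat eq_sym.
Qed.

(** * Positivity of the leading time coefficient *)

Section time_coefficient.
Context {R : realType}.
Implicit Types (omega : R -> R) (J n r : nat) (sigma tau alpha : R).

Lemma alpha_itv J r : (r <= 2 * J)%N -> 0 <= (alpha_ J r : R) <= 1.
Proof.
move=> rJ; rewrite /alpha_ /dalpha mulr_ge0 ?invr_ge0//=.
have [J0|J0] := posnP (2 * J); first by rewrite J0 invr0 mulr0.
by rewrite ler_pdivrMr ?ltr0n// mul1r ler_nat.
Qed.

(** With [A = sigma^(1-alpha)] and [B = (1+sigma)^(1-alpha)], [(2 - alpha) c_0]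
equals [(sigma + alpha/2) (B - A) + A] once [n >= 2], and [B >= A > 0]. *)
Lemma c_gt0 sigma alpha n : 0 < sigma -> 0 <= alpha <= 1 -> 0 < c_ sigma alpha n 0.
Proof.
move=> s0 /andP[a0 a1]; rewrite /c_ /=.
have A0 : 0 < sigma `^ (1 - alpha) by rewrite powR_gt0.
case: ifP => // _.
have s10 : 0 < 1 + sigma by rewrite addr_gt0.
rewrite /a_ /b_ subrr add0r.
have powS y : 0 < y -> y `^ (2 - alpha) = y * y `^ (1 - alpha).
  move=> y0; rewrite -[X in _ = X * _]powRr1 ?(ltW y0)// -powRD ?(gt_eqF y0) ?implybT//.
  by congr (_ `^ _); ring.
rewrite !powS//.
have : sigma `^ (1 - alpha) <= (1 + sigma) `^ (1 - alpha).
  by rewrite ge0_ler_powR ?nnegrE ?subr_ge0 ?(ltW s0) ?(ltW s10)// lerDr.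
move: (sigma `^ (1 - alpha)) ((1 + sigma) `^ (1 - alpha)) A0 => A B A0 AB.
have p0 : 0 < 2 - alpha by lra.
have -> : A + ((2 - alpha)^-1 * ((1 + sigma) * B - sigma * A) - 2^-1 * (B + A)) =
  (2 - alpha)^-1 * (sigma * (B - A) + alpha / 2 * (B - A) + A).
  by field; rewrite gt_eqF.
rewrite mulr_gt0 ?invr_gt0// ltr_wpDl// addr_ge0// mulr_ge0 ?subr_ge0 ?divr_ge0//.
exact: ltW.
Qed.

Lemma chat_gt0 omega J tau sigma n : (0 < J)%N -> 0 < tau -> 0 < sigma ->
  (forall a, 0 <= a <= 1 -> 0 < omega a) -> 0 < chat omega J tau sigma n 0.
Proof.
move=> J0 tau0 s0 w0; rewrite /chat.
have term r : (r <= 2 * J)%N -> 0 < lambda_ omega J r *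
    (tau `^ (- alpha_ J r) / Gamma (2 - alpha_ J r)) * c_ sigma (alpha_ J r) n 0.
  move=> rJ; have a01 := alpha_itv J r rJ.
  rewrite mulr_gt0 ?c_gt0// mulr_gt0//; last first.
    by rewrite divr_gt0 ?powR_gt0// Gamma_gt0//; lra.
  rewrite /lambda_ /d_ /dalpha !mulr_gt0 ?w0 ?invr_gt0 ?ltr0n ?muln_gt0//.
  by case: ifP => _.
rewrite big_nat_recl//= ltr_wpDr//; last exact: term.
rewrite big_nat_cond sumr_ge0// => r /andP[/andP[_ rJ] _].
by rewrite ltW// term.
Qed.

End time_coefficient.

(** * Unique solvability *)

(** Finite dimension turns uniqueness for the homogeneous problem into
existence and uniqueness for every right-hand side. *)
Lemma linear_inj_exists_unique (K : fieldType) (vT : vectType K) (f : vT -> vT) :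
  linear f -> (forall u, f u = 0 -> u = 0) -> forall y, exists! x, f x = y.
Proof.
move=> lf f0 y.
pose F : {linear vT -> vT} := HB.pack f (GRing.isLinear.Build K vT vT *:%R f lf).
have ker0 : lker (linfun F) == 0%VS.
  apply/lker0P => u v; rewrite !lfunE /= => uv.
  apply/eqP; rewrite -subr_eq0; apply/eqP/f0.
  by rewrite -[f _]/(F (u - v)) linearB /= uv subrr.
have yF x : F (((linfun F)^-1)%VF x) = x.
  have := lker0_lfunVK ker0 x; rewrite lfunE. exact.
exists (((linfun F)^-1)%VF y); split; first exact: yF.
move=> x fx; have := lker0_lfunK ker0 x; rewrite lfunE/= fx. exact.
Qed.

Section scheme_theory.
Context {R : realType}.
Variables (L1 L2 T K1 K2 beta gamma : R) (M1 M2 N J : nat).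
Variables (omega : R -> R) (sigma : R).

Let h1 := L1 / M1%:R.
Let h2 := L2 / M2%:R.
Let tau := T / N%:R.

Definition scheme_lhs (u : grid_fun R M1 M2 N) (i j n : nat) : R :=
  \sum_(0 <= k < n) chat omega J tau sigma n k
                    * (at_ u i j (n - k) - at_ u i j (n - k - 1))
  + K1 * h1 `^ (- beta)
    * (\sum_(0 <= p < M1.+1) g_ beta (i%:Z - p%:Z) * at_sigma sigma u p j n)
  + K2 * h2 `^ (- gamma)
    * (\sum_(0 <= q < M2.+1) g_ gamma (j%:Z - q%:Z) * at_sigma sigma u i q n).

Definition on_boundary (i j : nat) : bool :=
  [|| i == 0, i == M1, j == 0 | j == M2]%N.

(** The whole scheme, all levels together, as one endomorphism of the space of
grid functions: the prescribed values enter through identity rows, so that the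
system is square. *)
Definition scheme_op (u : grid_fun R M1 M2 N) : grid_fun R M1 M2 N :=
  [ffun x : 'I_M1.+1 * 'I_M2.+1 * 'I_N.+1 =>
             if on_boundary x.1.1 x.1.2 || (x.2 == 0 :> nat) then u x
             else scheme_lhs u x.1.1 x.1.2 x.2].

Definition scheme_data (f : R -> R -> R -> R) (phi : R -> R -> R) :
    grid_fun R M1 M2 N :=
  [ffun x : 'I_M1.+1 * 'I_M2.+1 * 'I_N.+1 =>
             if on_boundary x.1.1 x.1.2 then 0
             else if x.2 == 0 :> nat then phi (x.1.1%:R * h1) (x.1.2%:R * h2)
             else f (x.1.1%:R * h1) (x.1.2%:R * h2)
                    ((x.2%:R - 1 + sigma) * tau)].

Hypotheses (M1_gt0 : (0 < M1)%N) (M2_gt0 : (0 < M2)%N).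

Lemma on_boundaryNE i j : (i <= M1)%N -> (j <= M2)%N ->
  ~~ on_boundary i j = (1 <= i <= M1 - 1)%N && (1 <= j <= M2 - 1)%N.
Proof. by rewrite /on_boundary => iM jM; apply/idP/idP; lia. Qed.

Lemma scheme_solutionP f phi (u : grid_fun R M1 M2 N) :
  is_scheme_solution L1 L2 T K1 K2 beta gamma J omega sigma f phi u <->
  scheme_op u = scheme_data f phi.
Proof.
have atE (i : 'I_M1.+1) (j : 'I_M2.+1) (n : 'I_N.+1) : at_ u i j n = u (i, j, n).
  by rewrite /at_ !inord_val.
split => [[Heq Hbd Hini]|E].
  apply/ffunP => -[[i j] n]; rewrite !ffunE/=.
  have iM := leq_ord i; have jM := leq_ord j; have nN := leq_ord n.
  case: ifPn => [/orP[bd|n0]|].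
  - by rewrite bd -atE Hbd.
  - rewrite n0; case: ifPn => [bd|]; first by rewrite -atE Hbd.
    rewrite on_boundaryNE// => /andP[i1 j1]; rewrite -Hini// -atE.
    by rewrite (eqP n0).
  - rewrite negb_or => /andP[nbd n0]; rewrite (negbTE nbd) (negbTE n0).
    move: nbd; rewrite on_boundaryNE// => /andP[i1 j1].
    have n1 : (1 <= n <= N)%N by rewrite lt0n n0.
    by rewrite /scheme_lhs (Heq _ _ _ i1 j1 n1) -/h1 -/h2 -/tau; ring.
have eqn i j n : (i <= M1)%N -> (j <= M2)%N -> (n <= N)%N ->
    (if on_boundary i j || (n == 0%N) then at_ u i j n else scheme_lhs u i j n) =
    if on_boundary i j then 0
    else if n == 0%N then phi (i%:R * h1) (j%:R * h2)
    else f (i%:R * h1) (j%:R * h2) ((n%:R - 1 + sigma) * tau).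
  move=> iM jM nN.
  have /ffunP/(_ (inord i, inord j, inord n)) := E.
  by rewrite !ffunE/= !inordK.
split.
- move=> i j n i1 j1 n1.
  have iM : (i <= M1)%N by lia.
  have jM : (j <= M2)%N by lia.
  have nN : (n <= N)%N by lia.
  have nbd : ~~ on_boundary i j by rewrite on_boundaryNE// i1 j1.
  have n0 : (n == 0%N) = false by lia.
  have := eqn i j n iM jM nN; rewrite (negbTE nbd) n0/= /scheme_lhs.
  rewrite -/h1 -/h2 -/tau => <-; ring.
- move=> i j n iM jM nN; rewrite -/(on_boundary i j) => bd.
  by have := eqn i j n iM jM nN; rewrite bd.
- move=> i j i1 j1.
  have iM : (i <= M1)%N by lia.
  have jM : (j <= M2)%N by lia.
  have nbd : ~~ on_boundary i j by rewrite on_boundaryNE// i1 j1.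
  by have := eqn i j 0%N iM jM isT; rewrite (negbTE nbd).
Qed.

Lemma scheme_op_linear : linear (scheme_op : {ffun _ -> R^o} -> {ffun _ -> R^o}).
Proof.
move=> a u v.
have atL i j n : at_ (a *: (u : {ffun _ -> R^o}) + v : grid_fun R M1 M2 N) i j n =
   a * at_ (u : grid_fun R M1 M2 N) i j n + at_ (v : grid_fun R M1 M2 N) i j n.
  by rewrite /at_ !ffunE.
have sumL (m : nat) (F A B C : nat -> R) : (forall k, C k = a * A k + B k) ->
    \sum_(0 <= k < m) F k * C k =
    a * \sum_(0 <= k < m) F k * A k + \sum_(0 <= k < m) F k * B k.
  move=> CE; rewrite mulr_sumr -big_split/=; apply: eq_bigr => k _.
  by rewrite CE; ring.
have sigmaL i j n : at_sigma sigma (a *: (u : {ffun _ -> R^o}) + v : grid_fun R M1 M2 N) i j n =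
   a * at_sigma sigma (u : grid_fun R M1 M2 N) i j n
   + at_sigma sigma (v : grid_fun R M1 M2 N) i j n.
  by rewrite /at_sigma !atL; ring.
apply/ffunP => x; rewrite !ffunE/=; case: ifP => // _.
rewrite /scheme_lhs.
rewrite (sumL _ _ _ _ _ (fun p => sigmaL p x.1.2 x.2)).
rewrite (sumL _ _ _ _ _ (fun q => sigmaL x.1.1 q x.2)).
rewrite (sumL _ _ (fun k => at_ (u : grid_fun R M1 M2 N) x.1.1 x.1.2 (x.2 - k)
   - at_ (u : grid_fun R M1 M2 N) x.1.1 x.1.2 (x.2 - k - 1))
  (fun k => at_ (v : grid_fun R M1 M2 N) x.1.1 x.1.2 (x.2 - k)
   - at_ (v : grid_fun R M1 M2 N) x.1.1 x.1.2 (x.2 - k - 1))); last first.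
  by move=> k; rewrite !atL; ring.
rewrite /GRing.scale/=; ring.
Qed.

Hypotheses (sigma_gt0 : 0 < sigma) (K1_ge0 : 0 <= K1) (K2_ge0 : 0 <= K2).
Hypotheses (beta_itv : 0 < beta <= 2) (gamma_itv : 0 < gamma <= 2).
Hypothesis chat0_gt0 : forall n, 0 < chat omega J tau sigma n 0.

(** Strong induction on the level; at each level the equation is tested at a
node where the absolute value is maximal. *)
Lemma scheme_solution0 (u : grid_fun R M1 M2 N) :
  is_scheme_solution L1 L2 T K1 K2 beta gamma J omega sigma
    (fun _ _ _ => 0) (fun _ _ => 0) u ->
  u = [ffun=> 0].
Proof.
move=> [Heq Hbd Hini].
suff u0 n : (n <= N)%N -> forall i j, (i <= M1)%N -> (j <= M2)%N -> at_ u i j n = 0.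
  apply/ffunP => -[[i j] n]; rewrite ffunE.
  by have := u0 n (leq_ord n) i j (leq_ord i) (leq_ord j); rewrite /at_ !inord_val.
elim/ltn_ind: n => n IH nN.
(* The maximum is taken over all nodes; on the boundary it is 0 at once. *)
pose U (x : 'I_M1.+1 * 'I_M2.+1) : R := `|at_ u x.1 x.2 n|.
have [/= [i j] _ Umax] := @Order.TotalTheory.arg_maxP _ _ _ (ord0, ord0) xpredT U isT.
have iM := leq_ord i; have jM := leq_ord j.
have umax p q : (p <= M1)%N -> (q <= M2)%N -> `|at_ u p q n| <= `|at_ u i j n|.
  move=> pM qM; have := Umax (inord p, inord q) isT.
  by rewrite /U/= !inordK.
suff v0 : at_ u i j n = 0.
  move=> p q pM qM; apply/eqP; rewrite -normr_le0.
  by rewrite (le_trans (umax p q pM qM))// v0 normr0.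
have [bd|] := boolP (on_boundary i j); first exact: Hbd.
rewrite on_boundaryNE// => /andP[i1 j1].
have [n0|n_gt0] := posnP n; first by rewrite n0 Hini.
have atS p q : (p <= M1)%N -> (q <= M2)%N -> at_sigma sigma u p q n = sigma * at_ u p q n.
  move=> pM qM; rewrite /at_sigma [at_ u p q n.-1]IH ?mulr0 ?addr0//; lia.
have := Heq i j n i1 j1; rewrite n_gt0 nN addr0 => /(_ isT).
(* The differences with [k >= 1] involve earlier levels only. *)
have -> : \sum_(0 <= k < n) chat omega J (T / N%:R) sigma n k *
    (at_ u i j (n - k) - at_ u i j (n - k - 1)) =
    chat omega J tau sigma n 0 * at_ u i j n.
  rewrite big_ltn// subn0 [at_ u i j (n - 1)]IH ?subr0//; last 2 first.
  - by lia.
  - by lia.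
  rewrite big_nat_cond big1 ?addr0// => k /andP[/andP[k0 kn] _].
  by rewrite !IH ?subr0 ?mulr0//; lia.
have -> : \sum_(0 <= p < M1.+1) g_ beta (i%:Z - p%:Z) * at_sigma sigma u p j n =
   sigma * \sum_(0 <= p < M1.+1) g_ beta (i%:Z - p%:Z) * at_ u p j n.
  rewrite mulr_sumr; apply: eq_big_nat => p /andP[_ pM].
  by rewrite atS// mulrCA.
have -> : \sum_(0 <= q < M2.+1) g_ gamma (j%:Z - q%:Z) * at_sigma sigma u i q n =
   sigma * \sum_(0 <= q < M2.+1) g_ gamma (j%:Z - q%:Z) * at_ u i q n.
  rewrite mulr_sumr; apply: eq_big_nat => q /andP[_ qM].
  by rewrite atS// mulrCA.
rewrite -/h1 -/h2.
set S1 := \sum_(0 <= p < M1.+1) _; set S2 := \sum_(0 <= q < M2.+1) _ => Ev.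
have vS1 : 0 <= at_ u i j n * S1 := g_row_form_ge0 beta (fun p => at_ u p j n)
  M1 i beta_itv iM (fun p pM => umax p j pM jM).
have vS2 : 0 <= at_ u i j n * S2 := g_row_form_ge0 gamma (fun q => at_ u i q n)
  M2 j gamma_itv jM (fun q qM => umax i q iM qM).
move: (at_ u i j n) Ev vS1 vS2 => v Ev vS1 vS2.
have A1 : 0 <= K1 * h1 `^ (- beta) * sigma by rewrite !mulr_ge0 ?powR_ge0// ltW.
have A2 : 0 <= K2 * h2 `^ (- gamma) * sigma by rewrite !mulr_ge0 ?powR_ge0// ltW.
have : chat omega J tau sigma n 0 * v ^+ 2 =
   - (K1 * h1 `^ (- beta) * sigma * (v * S1)
      + K2 * h2 `^ (- gamma) * sigma * (v * S2)).
  rewrite expr2 mulrA Ev; ring.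
move=> Ev2; apply/eqP; rewrite -sqrf_eq0 eq_le sqr_ge0 andbT.
rewrite -(pmulr_rle0 _ (chat0_gt0 n)) Ev2 oppr_le0.
by apply: addr_ge0; apply: mulr_ge0.
Qed.

Lemma scheme_exists_unique f phi : exists! u : grid_fun R M1 M2 N,
  is_scheme_solution L1 L2 T K1 K2 beta gamma J omega sigma f phi u.
Proof.
pose V : vectType R := {ffun 'I_M1.+1 * 'I_M2.+1 * 'I_N.+1 -> R^o}.
have inj (u : V) : scheme_op u = 0 :> V -> u = 0 :> V.
  move=> u0; rewrite (scheme_solution0 u); first by apply/ffunP => x; rewrite !ffunE.
  apply/scheme_solutionP; rewrite u0; apply/ffunP => x.
  by rewrite !ffunE; case: ifP => // _; case: ifP.
have [u [Eu uniq_u]] :=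
  @linear_inj_exists_unique R V scheme_op scheme_op_linear inj (scheme_data f phi).
exists u; split; first exact/scheme_solutionP.
by move=> w /scheme_solutionP; exact: uniq_u.
Qed.

End scheme_theory.

Theorem theorem3p1 (R : realType) (L1 L2 T K1 K2 beta gamma : R)
  (M1 M2 N J : nat) (omega : R -> R) (sigma : R)
  (f : R -> R -> R -> R) (phi : R -> R -> R)
  (L1_gt0 : 0 < L1) (L2_gt0 : 0 < L2) (T_gt0 : 0 < T)
  (K1_gt0 : 0 < K1) (K2_gt0 : 0 < K2)
  (beta_itv : 1 < beta <= 2) (gamma_itv : 1 < gamma <= 2)
  (M1_ge2 : (2 <= M1)%N) (M2_ge2 : (2 <= M2)%N)
  (N_ge1 : (1 <= N)%N) (J_ge1 : (1 <= J)%N)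
  (omega_ge0 : forall a : R, 0 <= a <= 1 -> 0 <= omega a)
  (omega_neq0 : forall a : R, 0 <= a <= 1 -> omega a != 0)
  (omega_int : (@lebesgue_measure R).-integrable `[0, 1] (EFin \o omega))
  (omega_int_gt0 : (0 < \int[@lebesgue_measure R]_(a in `[0%R, 1%R]) (omega a)%:E)%E)
  (sigma_gt0 : 0 < sigma)
  (sigma_root : sigma_eq_fun omega J (T / N%:R) sigma = 0)
  (phi_bnd : forall x y : R, 0 <= x <= L1 -> 0 <= y <= L2 ->
     [|| x == 0, x == L1, y == 0 | y == L2] -> phi x y = 0) :
  exists! u : grid_fun R M1 M2 N,
    is_scheme_solution L1 L2 T K1 K2 beta gamma J omega sigma f phi u.
Proof.
have omega_gt0 a : 0 <= a <= 1 -> 0 < omega a.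
  by move=> a01; rewrite lt_neqAle eq_sym omega_neq0// omega_ge0.
apply: scheme_exists_unique; rewrite ?(ltW K1_gt0) ?(ltW K2_gt0)//; try lra.
- exact: ltnW.
- exact: ltnW.
- by move=> n; apply: chat_gt0 => //; rewrite divr_gt0// ltr0n.
Qed.
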